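(* Let $k=0$ and let $a$ be a regular scale factor (extended evenly to negative arguments). Then $g_{\theta\theta}(\tau,\rho)$ and $g_{\phi\phi}(\tau,\rho,\theta)$ are continuous on $D_{\mathrm{polar}}$, where at points with $\rho=\rho_{\mathcal M_\tau}$ (i.e. $t_0(\tau,\rho)=0$) their values are defined as the limits as $t_0\to0$ (these limits exist).
   Context: A function $a:[0,\infty)\to[0,\infty)$ is a regular scale factor if: (a) $a(0)=0$; (b) $a$ is increasing and continuous on $[0,\infty)$, twice continuously differentiable on $(0,\infty)$, with an inverse function on $[0,\infty)$; (c) $\frac{a(t)\ddot a(t)}{\dot a(t)^2}\le1$ for all $t>0$ (presupposing $\dot a(t)\ne0$). Extend $a$ by $a(-t)=a(t)$. For $0<s<\tau$, $\chi_s(\tau)=\int_s^\tau\frac{1}{a(t)}\frac{a(\tau)}{\sqrt{a^2(\tau)-a^2(t)}}dt$. For $\tau>0$, $\rho_{\mathcal M_\tau}=\int_0^\tau\frac{a(t)}{\sqrt{a^2(\tau)-a^2(t)}}dt$; for $0<\rho<2\rho_{\mathcal M_\tau}$, $t_0(\tau,\rho)$ is the unique $t_0\in(-\tau,\tau)$ with $\rho=\int_{t_0}^\tau\frac{a(t)}{\sqrt{a^2(\tau)-a^2(t)}}dt$. Define $f(\tau,t_0)=\int_{t_0}^{\tau}\frac{\ddot a(t)}{\dot a(t)^2}\left(\frac{\sqrt{a^2(\tau)-a^2(t_0)}}{\sqrt{a^2(\tau)-a^2(t)}}-1\right)dt$ for $0\le t_0<\tau$, $f(\tau,t_0)=2f(\tau,0)-f(\tau,-t_0)$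 for $-\tau<t_0<0$, and $g_{\tau\tau}(\tau,\rho)=-[1-\dot a(\tau)f(\tau,t_0(\tau,\rho))]^2$. Let $\rho_{\max}(\tau)=\inf\{\rho\in(0,2\rho_{\mathcal M_\tau}):g_{\tau\tau}(\tau,\rho)=0\}$ if this set is nonempty, else $2\rho_{\mathcal M_\tau}$. $D_{\mathrm{polar}}=\{(\tau,\rho,\theta,\phi):\tau>0,\ 0<\rho<\rho_{\max}(\tau),\ \theta\in I_\pi,\ \phi\in I_{2\pi}\}$, with $I_\pi,I_{2\pi}$ open intervals of lengths $\pi,2\pi$. For $t_0=t_0(\tau,\rho)\ne0$ and $k=0$: $g_{\theta\theta}(\tau,\rho)=a^2(t_0)\chi_{|t_0|}(\tau)^2$ and $g_{\phi\phi}(\tau,\rho,\theta)=g_{\theta\theta}(\tau,\rho)\sin^2\theta$. *)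

(* Defs.v *)
From HB Require Import structures.
From mathcomp Require Import all_boot all_order all_algebra.
From mathcomp Require Import all_classical all_reals all_analysis.
Set Implicit Arguments. Unset Strict Implicit. Unset Printing Implicit Defensive.
Import Order.TTheory GRing.Theory Num.Theory.
Import numFieldNormedType.Exports.
Local Open Scope classical_set_scope.
Local Open Scope ring_scope.

Section Defs.
Variable R : realType.

Definition integ (lo hi : R) (f : R -> R) : R :=
  fine (\int[lebesgue_measure]_(x in `]lo, hi[) (f x)%:E)%E.

Definition adot (a : R -> R) : R -> R := derive1 a.
Definition addot (a : R -> R) : R -> R := derive1 (derive1 a).

(* regular scale factor (a is given on all of R; only its values on [0,oo)
   matter here, the even extension is imposed separately) *)
Definition regular_scale_factor (a : R -> R) : Prop :=
  a 0 = 0 /\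
      (* increasing (strictly, since it has an inverse) on [0,oo) *)
      (forall x y, 0 <= x -> x < y -> a x < a y) /\
      {within `[0, +oo[, continuous a} /\
      (* a : [0,oo) -> [0,oo) has an inverse function defined on [0,oo) *)
      (forall y, 0 <= y -> exists2 x, 0 <= x & a x = y) /\
      (forall t, 0 < t -> [/\ derivable a t 1, derivable (derive1 a) t 1 &
                              {for t, continuous (addot a)}]) /\
      (* condition (c), presupposing adot a t <> 0 *)
      (forall t, 0 < t -> adot a t != 0 /\
                 a t * addot a t / (adot a t) ^+ 2 <= 1).

Definition chi (a : R -> R) (s tau : R) : R :=
  integ s tau (fun t => 1 / a t * (a tau / Num.sqrt (a tau ^+ 2 - a t ^+ 2))).

Definition rhoM (a : R -> R) (tau : R) : R :=
  integ 0 tau (fun t => a t / Num.sqrt (a tau ^+ 2 - a t ^+ 2)).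

(* t0(tau, rho): the unique t0 in (-tau, tau) with
   rho = int_{t0}^tau a(t)/sqrt(a^2(tau)-a^2(t)) dt *)
Definition t0 (a : R -> R) (tau rho : R) : R :=
  xget 0 [set s | -tau < s < tau /\
     rho = integ s tau (fun t => a t / Num.sqrt (a tau ^+ 2 - a t ^+ 2))].

Definition fpos (a : R -> R) (tau s : R) : R :=
  integ s tau (fun t => addot a t / (adot a t) ^+ 2 *
    (Num.sqrt (a tau ^+ 2 - a s ^+ 2) / Num.sqrt (a tau ^+ 2 - a t ^+ 2) - 1)).

Definition ff (a : R -> R) (tau s : R) : R :=
  if 0 <= s then fpos a tau s else 2 * fpos a tau 0 - fpos a tau (- s).

Definition g_tautau (a : R -> R) (tau rho : R) : R :=
  - (1 - adot a tau * ff a tau (t0 a tau rho)) ^+ 2.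

Definition rho_max (a : R -> R) (tau : R) : R :=
  let S := [set rho | 0 < rho < 2 * rhoM a tau /\ g_tautau a tau rho = 0] in
  if pselect (S !=set0) is left _ then inf S else 2 * rhoM a tau.

Definition Dpolar (a : R -> R) (th0 ph0 : R) : set (R * R * R * R) :=
  [set p | 0 < p.1.1.1 /\ 0 < p.1.1.2 < rho_max a p.1.1.1 /\
           th0 < p.1.2 < th0 + pi /\ ph0 < p.2 < ph0 + 2 * pi].

(* g_thth and g_phph (k = 0), written as functions of t0 (for t0 <> 0) *)
Definition gth_t0 (a : R -> R) (tau s : R) : R :=
  a s ^+ 2 * chi a `|s| tau ^+ 2.
Definition gph_t0 (a : R -> R) (tau s th : R) : R :=
  gth_t0 a tau s * sin th ^+ 2.

(* g_thth(tau, rho), g_phph(tau, rho, theta), meaningful when t0(tau,rho) <> 0 *)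
Definition g_thth (a : R -> R) (tau rho : R) : R := gth_t0 a tau (t0 a tau rho).
Definition g_phph (a : R -> R) (tau rho th : R) : R :=
  gph_t0 a tau (t0 a tau rho) th.

End Defs.

(* Main.v *)
(**
With the substitution [t = tau x], both the radial distance [rho] and
[a(s) chi_|s|(tau)] become integrals over the fixed interval [-1 < x < 1] whose
integrands depend on [(tau, s)], continuously for almost every [x]. The mean value
theorem gives [a(tau)^2 - a(tau x)^2 >= c (1 - x^2)] locally uniformly in [tau], so
both integrands are dominated by [C / sqrt (1 - x^2)] and the integrals are jointly
continuous in [(tau, s)]. As [rho] is strictly decreasing in [s], [t0] is continuous.
Since [a(s) / a(t) <= 1] for [|s| < t], the domination persists down to [s = 0],
where the integrand of [a(s) chi_|s|(tau)] vanishes: the limit of [g_thth] as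
[t0 -> 0] is [0], which is also the value of [g_thth] there because [a 0 = 0].
*)
Require Import Defs.
From HB Require Import structures.
From mathcomp Require Import all_boot all_order all_algebra.
From mathcomp Require Import all_classical all_reals all_analysis.
From mathcomp Require Import measurable_realfun ring lra.
Import Order.TTheory GRing.Theory Num.Theory.
Import numFieldNormedType.Exports.
Local Open Scope classical_set_scope.
Local Open Scope ring_scope.
Set Implicit Arguments.
Unset Strict Implicit.
Unset Printing Implicit Defensive.

(** * Integration on the real line *)

(** If the limit failed, the balls of radius [n.+1%:R^-1] would each contain a bad point of [U], and
    these points would form a sequence tending to [p]. Keeping the sequence inside [U] lets a bound
    valid only near [p] hold for every term. *)
Lemma cvg_at_seq (R : realType) (V : pseudoMetricType R) (f : V -> R) (p : V)
    (l : R) (U : set V) : nbhs p U ->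
  (forall u : nat -> V, (forall n, U (u n)) -> u n @[n --> \oo] --> p ->
     f (u n) @[n --> \oo] --> l) ->
  f x @[x --> p] --> l.
Proof.
move=> nU cu; apply/cvgrPdist_lt => e e0; apply: contrapT => nf.
have H n : exists x, [/\ U x, ball p n.+1%:R^-1 x & e <= `|l - f x|].
  apply: contrapT => /forallNP nx; apply: nf.
  have nb : nbhs p (ball p (n.+1%:R^-1 : R)) by apply: nbhsx_ballx; rewrite invr_gt0.
  near=> x; rewrite ltNge; apply/negP => ex; apply: (nx x); split=> //.
    by near: x.
  by near: x.
pose u n := sval (cid (H n)).
have uP n : [/\ U (u n), ball p n.+1%:R^-1 (u n) & e <= `|l - f (u n)|].
  by rewrite /u; case: cid.
have cup : u n @[n --> \oo] --> p.
  apply/cvg_ballP => d d0; near=> n.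
  apply: (@le_ball _ _ _ (n.+1%:R^-1)); last by case: (uP n).
  rewrite -[leRHS]invrK lef_pV2 ?posrE ?invr_gt0//.
  near: n; exists (Num.truncn d^-1) => // s /= rs.
  by apply/ltW; rewrite -truncn_le_nat.
have /cvgrPdist_lt/(_ e e0) [n _ /(_ n (leqnn n))] :=
  cu u (fun n => let: And3 h _ _ := uP n in h) cup.
by rewrite /= ltNge; case: (uP n) => _ _ ->.
Unshelve. all: by end_near. Qed.

(** Dominated convergence for a parameter in a metric space, reduced to sequences. The bound [g]
    also makes the limit kernel integrable, so taking [fine] preserves the limit. *)
Lemma cvg_Rintegral_dominated (R : realType) (V : pseudoMetricType R)
    (D : set R) (k : V -> R -> R) (g : R -> R) (p : V) :
  measurable D ->
  (forall q, measurable_fun D (k q)) ->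
  lebesgue_measure.-integrable D (EFin \o g) ->
  (\forall q \near p, forall x, D x -> `|k q x| <= g x) ->
  {ae lebesgue_measure, forall x, D x -> k q x @[q --> p] --> k p x} ->
  \int[lebesgue_measure]_(x in D) k q x @[q --> p] -->
  \int[lebesgue_measure]_(x in D) k p x.
Proof.
move=> mD mk ig kg kp; apply: (cvg_at_seq kg) => u uU up.
have mkE q : measurable_fun D (EFin \o k q) by exact/measurable_EFinP.
have ik : lebesgue_measure.-integrable D (EFin \o k p).
  apply: le_integrable ig => //; first exact: mkE.
  move=> x Dx /=; rewrite lee_fin.
  by have /(_ x Dx)/le_trans := nbhs_singleton kg; apply; exact: ler_norm.
have [] := @dominated_convergence _ _ _ lebesgue_measure D mD
  (fun n => EFin \o k (u n)) (EFin \o k p) (EFin \o g).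
- by move=> n; exact: mkE.
- exact: mkE.
- case: kp => N [mN N0 subN]; exists N; split=> // x /= nx; apply: subN => /= kpx.
  apply: nx => Dx; apply: cvg_EFin; first by near=> n.
  exact: (cvg_comp _ _ up (kpx Dx)).
- exact: ig.
- by apply/aeW => x n Dx /=; rewrite lee_fin; exact: uU.
move=> _ _ H.
have /= := H.
rewrite -(@fineK _ (\int[lebesgue_measure]_(x in D) (EFin \o k p) x)%E); last first.
  exact: integrable_fin_num.
by move/fine_cvgP => [_].
Unshelve. all: by end_near. Qed.

(** * Scaling and reflection of Lebesgue integrals *)

Section change_of_variable.
Local Open Scope ereal_scope.
Context {R : realType}.
Implicit Types (D : set R) (f : R -> \bar R).

Let mulc_measurable (c : R) : measurable_fun setT
  ((fun x => c * x)%R : measurableTypeR R -> measurableTypeR R).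
Proof.
suff: measurable_fun setT (fun x : R => c * x)%R by [].
exact: measurable_funM.
Qed.

Let mulc (c : R) : measurableTypeR R -> measurableTypeR R := fun x => (c * x)%R.

(** By uniqueness of Lebesgue measure: [c] times the pushforward along multiplication by [c] gives
    each interval []a, b]] its length. *)
Lemma lebesgue_measureZ (c : R) (c0 : (0 < c)%R) (A : set R) : measurable A ->
  lebesgue_measure A =
  c%:E * lebesgue_measure ((fun x => c * x)%R @^-1` A).
Proof.
move=> mA.
pose pf : {measure set (measurableTypeR R) -> \bar R} :=
  pushforward lebesgue_measure (mulc c).
pose m : {measure set (measurableTypeR R) -> \bar R} :=
  mscale (NngNum (ltW c0)) (pf (mulc_measurable c)).
have -> : c%:E * lebesgue_measure ((fun x => c * x)%R @^-1` A) = m A by [].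
apply: lebesgue_measure_unique => //= _ [[a b]] _ <-.
have E : mulc c @^-1` `]a, b] = `](a / c)%R, (b / c)%R]%classic.
  apply/seteqP; split=> x /=; rewrite /mulc !in_itv/= ltr_pdivrMr// ler_pdivlMr//;
  by rewrite [(x * c)%R]mulrC.
transitivity (c%:E * lebesgue_measure `](a / c)%R, (b / c)%R]%classic); last first.
  by rewrite -E.
rewrite !lebesgue_measure_itv/= !lte_fin ltr_pM2r ?invr_gt0//.
case: ifP => _; rewrite ?mule0// -!EFinB -EFinM; congr EFin.
by rewrite -mulrBl mulrCA divff ?gt_eqF// mulr1.
Qed.

Lemma ge0_integral_scale (c : R) D f : (0 < c)%R -> measurable D ->
  measurable_fun setT f -> (forall x, 0 <= f x) ->
  \int[lebesgue_measure]_(x in D) f x =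
  c%:E * \int[lebesgue_measure]_(x in (fun x => c * x)%R @^-1` D) f (c * x)%R.
Proof.
move=> c0 mD mf f0.
pose pf : {measure set (measurableTypeR R) -> \bar R} :=
  pushforward lebesgue_measure (mulc c).
pose m : {measure set (measurableTypeR R) -> \bar R} :=
  mscale (NngNum (ltW c0)) (pf (mulc_measurable c)).
transitivity (\int[m]_(x in D) f x).
  by apply: eq_measure_integral => A mA _; exact: lebesgue_measureZ.
rewrite ge0_integral_mscale//=; last exact: measurable_funTS.
rewrite ge0_integral_pushforward//.
exact: measurable_funTS.
Qed.

Lemma ge0_integral_opp D f : measurable D ->
  measurable_fun setT f -> (forall x, 0 <= f x) ->
  \int[lebesgue_measure]_(x in D) f x =
  \int[lebesgue_measure]_(x in -%R @^-1` D) f (- x)%R.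
Proof.
move=> mD mf f0.
have mopp : measurable_fun setT (-%R : measurableTypeR R -> measurableTypeR R).
  suff: measurable_fun setT (-%R : R -> R) by [].
  exact: measurable_funN.
pose pf : {measure set (measurableTypeR R) -> \bar R} :=
  pushforward lebesgue_measure (-%R : measurableTypeR R -> measurableTypeR R).
transitivity (\int[pf mopp]_(x in D) f x).
  by apply: eq_measure_integral => A mA _; exact/esym/lebesgue_measureN.
rewrite ge0_integral_pushforward//.
exact: measurable_funTS.
Qed.

End change_of_variable.

(** This density is the common majorant of the kernels. On the closed intervals [F n] exhausting
    []-1, 1[] its primitive [asin] bounds the integral by [pi], and monotone convergence carries the
    bound to the union. *)
Lemma integrable_arcsine (R : realType) :
  lebesgue_measure.-integrable `]-1, 1[
    (EFin \o (fun x : R => (Num.sqrt (1 - x ^+ 2))^-1)).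
Proof.
pose h (x : R) := (Num.sqrt (1 - x ^+ 2))^-1.
have ch (x : R) : -1 < x < 1 -> {for x, continuous h}.
  move=> /andP[x1 x2]; apply: cvgV.
    by rewrite gt_eqF// sqrtr_gt0; nra.
  apply: cvg_comp; last exact: sqrt_continuous.
  by apply: cvgB; [exact: cvg_cst|exact: exprn_continuous].
(* Starting at [n.+2] keeps [e n] strictly below 1, so that [F n] is never degenerate. *)
pose e (n : nat) : R := n.+2%:R^-1.
pose F (n : nat) : set R := `[-1 + e n, 1 - e n]%classic.
have e01 n : 0 < e n < 1 by rewrite invr_gt0 ltr0n/= invf_lt1// ltr1n.
have eS n : e n.+1 <= e n by rewrite lef_pV2 ?posrE// ler_nat.
have ndF : nondecreasing_seq F.
  apply/nondecreasing_seqP => n; apply/subsetPset => x.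
  rewrite /F /= !in_itv/=; have := eS n.
  by move=> ? /andP[? ?]; apply/andP; split; lra.
have UF : \bigcup_n F n = `]-1, 1[%classic.
  apply/seteqP; split=> x.
    move=> [n _]; rewrite /F /= !in_itv/= => /andP[? ?].
    by have /andP[? ?] := e01 n; apply/andP; split; lra.
  rewrite /= in_itv/= => /andP[x1 x2].
  pose d := Num.min (1 - x) (1 + x).
  have d0 : 0 < d by rewrite lt_min; apply/andP; split; lra.
  exists (Num.truncn d^-1) => //.
  have : e (Num.truncn d^-1) <= d.
    rewrite -[leRHS]invrK lef_pV2 ?posrE ?invr_gt0//.
    by apply: ltW; rewrite -truncn_le_nat.
  rewrite /F /= in_itv/= le_min => /andP[? ?].
  by apply/andP; split; lra.
have mh : measurable_fun (`]-1, 1[%classic : set R) h.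
  apply: open_continuous_measurable_fun; first exact: interval_open.
  by move=> x /[!inE]/=; rewrite in_itv/=; exact: ch.
have mhE : measurable_fun (`]-1, 1[%classic : set R) (EFin \o h) by exact/measurable_EFinP.
have h0 x : 0 <= h x by rewrite invr_ge0 sqrtr_ge0.
apply/integrableP; split; first exact: mhE.
rewrite (_ : (fun x => _) = (EFin \o h)); last first.
  by apply/funext => x /=; rewrite ger0_norm.
rewrite -UF.
have mF n : measurable (F n) by exact: measurable_itv.
have FS n : F n `<=` `]-1, 1[%classic by rewrite -UF; exact: bigcup_sup.
have Hc : (\int[lebesgue_measure]_(x in F n) (EFin \o h) x)%E @[n --> \oo] -->
    (\int[lebesgue_measure]_(x in \bigcup_n F n) (EFin \o h) x)%E.
  apply: ge0_nondecreasing_set_cvg_integral => // n.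
    exact: (measurable_funS _ (FS n) mhE).
  by move=> x _; rewrite /= lee_fin.
apply: (@le_lt_trans _ _ (pi%:E : \bar R)); last exact: ltry.
rewrite -(cvg_lim _ Hc)//; apply: lime_le; first by apply/cvg_ex; eexists; exact: Hc.
have din x n : x \in `[-1 + e n, 1 - e n] -> -1 < x < 1.
  rewrite in_itv/= => /andP[? ?].
  by have /andP[? ?] := e01 n; apply/andP; split; lra.
near=> n.
have en : 0 < e n < 1 := e01 n.
have en1 : e n <= 3^-1.
  rewrite /e lef_pV2 ?posrE//.
  by rewrite (ler_nat R 3 n.+2) ltnS; near: n; exists 1%N.
have lt : -1 + e n < 1 - e n by lra.
rewrite /F (continuous_FTC2 (F := @asin R))//; first last.
- move=> x /subset_itv_oo_cc /din x1; rewrite derive1E.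
  by have [_ ->] := is_derive1_asin x1.
- split.
  + move=> x /subset_itv_oo_cc /din x1.
    by have [] := is_derive1_asin x1.
  + by apply: cvg_at_right_filter; apply: continuous_asin; apply: (din _ n);
      rewrite in_itv/= lexx ltW.
  + by apply: cvg_at_left_filter; apply: continuous_asin; apply: (din _ n);
      rewrite in_itv/= lexx ltW.
- by apply: continuous_in_subspaceT => x /set_mem /din; exact: ch.
rewrite -EFinB lee_fin.
have h1 : asin (1 - e n) <= pi / 2 :> R by apply: asin_lepi2; lra.
have h2 : - (pi / 2) <= asin (-1 + e n) :> R by apply: asin_geNpi2; lra.
have -> : pi = pi / 2 + pi / 2 :> R by rewrite -splitr.
by rewrite lerD// lerNl.
Unshelve. all: by end_near. Qed.

(** Away from a tie [u p = v p] the test is constant near [p], so a cut-off function can jump only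
    at ties. *)
Lemma cvg_if_lt (R : realType) (V : topologicalType) (u v h : V -> R) (p : V) :
  u q @[q --> p] --> u p -> v q @[q --> p] --> v p -> u p != v p ->
  (u p < v p -> h q @[q --> p] --> h p) ->
  (if u q < v q then h q else 0) @[q --> p] --> (if u p < v p then h p else 0).
Proof.
move=> cu cv; rewrite neq_lt => /orP uv ch.
have cvu : v q - u q @[q --> p] --> v p - u p by exact: cvgB.
case: uv => uv.
  rewrite uv; apply: cvg_trans (ch uv); apply: near_eq_cvg.
  have : \forall q \near p, 0 < v q - u q.
    by apply: (@cvgr_gt _ _ (nbhs p) _ (fun q => v q - u q) _ cvu); rewrite subr_gt0.
  by apply: filterS => q; rewrite subr_gt0 => ->.
rewrite ltNge (ltW uv) /=.
have c0 : (fun _ : V => 0 : R) q @[q --> p] --> (0 : R) by exact: cvg_cst.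
apply: cvg_trans c0; apply: near_eq_cvg.
have : \forall q \near p, v q - u q < 0.
  by apply: (@cvgr_lt _ _ (nbhs p) _ (fun q => v q - u q) _ cvu); rewrite subr_lt0.
by apply: filterS => q; rewrite subr_lt0 => h'; rewrite ltNge (ltW h').
Qed.

(** * Elementary limits and measurability *)

Lemma cvg_sqrt (R : realType) (T : Type) (F : set_system T) (FF : Filter F)
    (f : T -> R) (l : R) :
  f x @[x --> F] --> l -> Num.sqrt (f x) @[x --> F] --> Num.sqrt l.
Proof. by move=> fl; apply: continuous_cvg fl; exact: sqrt_continuous. Qed.

Lemma cvg_sqr (R : realType) (T : Type) (F : set_system T) (FF : Filter F)
    (f : T -> R) (l : R) :
  f x @[x --> F] --> l -> f x ^+ 2 @[x --> F] --> l ^+ 2.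
Proof. by move=> fl; rewrite expr2; under eq_fun do rewrite expr2; exact: cvgM. Qed.

Lemma cvg_proj1 (U V : topologicalType) (p : U * V) : q.1 @[q --> p] --> p.1.
Proof. by case: p => x y; exact: (@cvg_fst _ _ (nbhs x) (nbhs y)). Qed.

Lemma cvg_proj2 (U V : topologicalType) (p : U * V) : q.2 @[q --> p] --> p.2.
Proof. by case: p => x y; exact: (@cvg_snd _ _ (nbhs x) (nbhs y)). Qed.

(** On nonnegative numbers, 0 included, the inverse is the measurable power of exponent -1. *)
Lemma measurable_fun_inv_ge0 (R : realType) (f : R -> R) :
  measurable_fun setT f -> (forall x, 0 <= f x) ->
  measurable_fun setT (fun x => (f x)^-1).
Proof.
move=> mf f0; rewrite (_ : (fun x => _) = (fun x => f x `^ (-1))).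
  exact: measurableT_comp (measurable_powR _) mf.
by apply/funext => x; rewrite powR_inv1.
Qed.

Lemma measurable_fun_sqrt (R : realType) (f : R -> R) :
  measurable_fun setT f -> measurable_fun setT (fun x => Num.sqrt (f x)).
Proof.
apply: measurableT_comp.
by apply: continuous_measurable_fun; exact: sqrt_continuous.
Qed.

(** Infinite [I] is covered: [fine] sends infinity to 0, and for [c = 0] the product is already
    0. *)
Lemma ge0_fineM (R : realType) (c : R) (I : \bar R) :
  0 <= c -> (0 <= I)%E -> fine (c%:E * I) = c * fine I.
Proof.
move=> c0; case: I => [r|_|]//=.
have [->|cn0] := eqVneq c 0; first by rewrite mul0e mul0r.
by rewrite gt0_muley ?mulr0// lte_fin lt_neqAle eq_sym cn0.
Qed.

(** The substitution [t = tau * x] makes the domain independent of [tau] and [s]; the lower limit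
    survives as a test in the integrand. The equality is proved before [fine] is applied, so it also
    covers infinite integrals. *)
Lemma integ_scale (R : realType) (g : R -> R) (s tau : R) :
  0 < tau -> - tau <= s -> measurable_fun setT g -> (forall x, 0 <= g x) ->
  integ s tau g =
  \int[lebesgue_measure]_(x in `]-1, 1[)
    (if s < tau * x then tau * g (tau * x) else 0).
Proof.
move=> tau0 ts mg g0; rewrite /integ /Rintegral; congr fine.
have mgE : measurable_fun setT (EFin \o g) by exact/measurable_EFinP.
have mgs : measurable_fun setT (fun x : R => g (tau * x)).
  by apply: (measurableT_comp mg); exact: measurable_funM.
have mgsE : measurable_fun setT (EFin \o (fun x : R => g (tau * x))).
  exact/measurable_EFinP.
rewrite (ge0_integral_scale tau0 (f := EFin \o g))//=.
have mP : measurable [set x | s < tau * x].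
  rewrite (_ : [set _ | _] = `]s / tau, +oo[%classic) //.
  by apply/seteqP; split=> x /=; rewrite in_itv/= andbT ltr_pdivrMr// mulrC.
rewrite (_ : (fun x => tau * x) @^-1` _ = `]-1, 1[ `&` [set x | s < tau * x]).
  rewrite -ge0_integralZl//=; last 4 first.
  - by apply: measurableI => //; exact: measurable_itv.
  - exact: (measurable_funTS mgsE).
  - by move=> x _; rewrite lee_fin.
  - by rewrite lee_fin ltW.
  rewrite integral_mkcondr; apply: eq_integral => x _.
  rewrite patchE; case: ifPn => [/set_mem/= ->|/negP nx]; first by rewrite EFinM.
  by rewrite ifF//; apply/negbTE/negP => sx; apply/nx/mem_set.
apply/seteqP; split=> x /=; rewrite !in_itv/=.
  by move=> /andP[h1 h2]; split=> //; apply/andP; split; nra.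
by move=> [/andP[h1 h2] h3]; rewrite h3 /=; nra.
Qed.

(** * Scale factors *)

Section ScaleFactor.
Context {R : realType} (a : R -> R).
Hypothesis ra : regular_scale_factor a.
Hypothesis even_a : forall t, a (- t) = a t.

Lemma scale_norm t : a `|t| = a t.
Proof. by have [?|?] := ger0P t; rewrite ?even_a. Qed.

Lemma scale0 : a 0 = 0. Proof. by case: ra. Qed.

(** Evenness turns monotonicity on the half-line into a comparison of absolute values, which handles
    arguments of either sign at once. *)
Lemma scale_lt x y : `|x| < `|y| -> a x < a y.
Proof.
by move=> xy; rewrite -(scale_norm x) -(scale_norm y); case: ra => _ [+ _]; apply.
Qed.

Lemma scale_le x y : `|x| <= `|y| -> a x <= a y.
Proof.
rewrite le_eqVlt => /predU1P[xy|/scale_lt/ltW//].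
by rewrite -(scale_norm x) xy scale_norm.
Qed.

Lemma scale_ge0 x : 0 <= a x.
Proof. by rewrite -scale0; apply: scale_le; rewrite normr0. Qed.

Lemma scale_gt0 x : x != 0 -> 0 < a x.
Proof. by move=> x0; rewrite -scale0; apply: scale_lt; rewrite normr0 normr_gt0. Qed.

(** [a] is its own composite with the absolute value, whose values lie in the half-line where
    continuity is assumed. *)
Lemma scale_continuous : continuous a.
Proof.
have aE : (fun t => a `|t|) = a by apply/funext => x; rewrite scale_norm.
rewrite -aE.
case: ra => _ [_ [/subspace_continuousP ca _]] t.
apply: cvg_comp (ca `|t| _); last by rewrite /= in_itv/= andbT.
move=> U; rewrite /within /= => nU.
suff : \forall x \near t, U `|x| by [].
have : \forall x \near t, `|x| \in `[0, +oo[ -> U `|x|.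
  exact: (@norm_continuous _ _ t _ nU).
apply: filterS => x.
by apply; rewrite in_itv/= andbT.
Qed.

Lemma adot_continuous t : 0 < t -> {for t, continuous (adot a)}.
Proof.
move=> t0; case: ra => _ [_ [_ [_ [/(_ t t0)[_ d _] _]]]].
exact/differentiable_continuous/derivable1_diffP.
Qed.

(** With [m] the minimum of [|adot a|] on [[tau0 / 4, 2 * tau0]], the mean value theorem bounds
    [a tau - a (tau * x)] below by a multiple of [1 - |x|]. The other factor of the difference of
    squares is at least [a (tau0 / 2)]. *)
Lemma scale_gap (tau0 : R) : 0 < tau0 ->
  exists2 c, 0 < c & forall tau x, tau0 / 2 < tau < 2 * tau0 -> -1 < x < 1 ->
    c * (1 - x ^+ 2) <= a tau ^+ 2 - a (tau * x) ^+ 2.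
Proof.
move=> tau00.
have [u uI um] : exists2 u, u \in `[tau0 / 4, 2 * tau0]%R &
    forall t, t \in `[tau0 / 4, 2 * tau0]%R -> `|adot a u| <= `|adot a t|.
  apply: (@EVT_min _ (fun t => `|adot a t|)); first lra.
  apply: continuous_in_subspaceT => x /set_mem /=; rewrite in_itv/= => /andP[? ?].
  by apply: cvg_norm; apply: adot_continuous; lra.
have m0 : 0 < `|adot a u|.
  rewrite normr_gt0; case: ra => _ [_ [_ [_ [_ /(_ u)[]//]]]].
  by move: uI; rewrite in_itv/= => /andP[? ?]; lra.
set m := `|adot a u| in m0 um.
have mvt y z : tau0 / 4 <= y -> y <= z -> z <= 2 * tau0 -> m * (z - y) <= a z - a y.
  move=> y1 yz z2.
  have [||v vI aE] := @MVT_segment R a (adot a) y z yz.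
  - move=> v; rewrite in_itv/= => /andP[? ?].
    have v0 : 0 < v by lra.
    case: ra => _ [_ [_ [_ [/(_ v v0)[d _ _] _]]]].
    by rewrite /adot derive1E; exact/derivableP.
  - by apply: continuous_subspaceT; exact: scale_continuous.
  (* The sign of [adot a] is never determined: since [a z - a y] is nonnegative, the mean value
     identity can be taken in absolute value. *)
  have a0 : 0 <= a z - a y by rewrite subr_ge0; apply: scale_le; rewrite !ger0_norm; lra.
  rewrite -(ger0_norm a0) aE normrM (@ger0_norm _ (z - y)) ?subr_ge0//.
  apply: ler_wpM2r; first by rewrite subr_ge0.
  by apply: um; move: vI; rewrite !in_itv/= => /andP[? ?]; apply/andP; split; lra.
have A0 : 0 < a (tau0 / 2) by apply: scale_gt0; rewrite gt_eqF// divr_gt0.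
(* The 8 is the 4 of [lin] below, doubled because [1 - x ^+ 2 <= 2 * (1 - x)] for [0 <= x < 1]. *)
exists (a (tau0 / 2) * (m * tau0 / 8)).
  by rewrite mulr_gt0// divr_gt0// mulr_gt0.
move=> tau x /andP[t1 t2] x1.
have tau_gt0 : 0 < tau by lra.
(* Both sides are even in [x], so [x] is replaced by its absolute value. *)
rewrite -(scale_norm (tau * x)) normrM (gtr0_norm tau_gt0) -(real_normK (num_real x)).
have : `|x| < 1 by rewrite ltr_norml.
move: (normr_ge0 x); move: `|x| => {x1}x x0 x1.
have lin : m * tau0 / 4 * (1 - x) <= a tau - a (tau * x).
  have [h|h] := leP (tau0 / 4) (tau * x).
    apply: le_trans (mvt _ _ h _ (ltW t2)); last nra.
    rewrite (_ : tau - tau * x = tau * (1 - x)); last by ring.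
    rewrite mulrA; apply: ler_wpM2r; first lra.
    by rewrite -mulrA; apply: ler_wpM2l; [exact: ltW|lra].
  (* Here [tau * x] may leave the interval where [m] controls the derivative. It is compared with
     [tau / 2], which exceeds [tau0 / 4], and the increase from [tau / 2] to [tau] already
     suffices. *)
  have hh : a (tau * x) <= a (tau / 2).
    by apply: scale_le; rewrite !ger0_norm; nra.
  have := mvt (tau / 2) tau.
  have -> : tau - tau / 2 = tau / 2 by lra.
  move=> /(_ _ _ (ltW t2)) H.
  apply: (@le_trans _ _ (m * (tau / 2))).
    rewrite -!mulrA; apply: ler_wpM2l; [exact: ltW|nra].
  apply: le_trans (H _ _) _; lra.
have L0 : 0 <= m * tau0 / 4 * (1 - x).
  by rewrite mulr_ge0//; [rewrite divr_ge0// mulr_ge0// ltW|lra].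
rewrite subr_sqr.
have As : a (tau0 / 2) <= a tau + a (tau * x).
  rewrite -[leLHS]addr0; apply: lerD; last exact: scale_ge0.
  by apply: scale_le; rewrite !ger0_norm; lra.
apply: (@le_trans _ _ (a (tau0 / 2) * (m * tau0 / 4 * (1 - x)))).
  rewrite -!mulrA; apply: ler_wpM2l; first exact: ltW.
  apply: ler_wpM2l; first exact: ltW.
  by apply: ler_wpM2l; [exact: ltW|nra].
rewrite [leRHS]mulrC; apply: ler_pM => //; exact: ltW.
Qed.

(** * The square root in the denominator *)

Definition denom (tau t : R) : R := Num.sqrt (a tau ^+ 2 - a t ^+ 2).

(** One constant serves all [tau] in [(tau0 / 2, 2 * tau0)]: there [tau] and [a tau] are bounded by
    their values at [2 * tau0], and [scale_gap] bounds the root below. *)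
Lemma denom_bound (tau0 : R) : 0 < tau0 ->
  exists C, \forall tau \near tau0, 0 < tau /\ forall x, -1 < x < 1 ->
    tau * (a tau / denom tau (tau * x)) <= C * (Num.sqrt (1 - x ^+ 2))^-1.
Proof.
move=> tau00; have [c c0 gap] := scale_gap tau00.
exists (2 * tau0 * (a (2 * tau0) / Num.sqrt c)).
have I : \forall tau \near tau0, tau0 / 2 < tau < 2 * tau0.
  near=> tau; apply/andP; split; near: tau.
    by apply: lt_nbhsr; lra.
  by apply: lt_nbhsl; lra.
apply: filterS I => tau /[dup] tI /andP[t1 t2].
have tau_gt0 : 0 < tau by lra.
split=> // x xI; have {}gap := gap _ _ tI xI.
have x2 : 0 < 1 - x ^+ 2 by move: xI => /andP[? ?]; nra.
have sq : Num.sqrt c * Num.sqrt (1 - x ^+ 2) <= denom tau (tau * x).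
  by rewrite -sqrtrM ?(ltW c0)// ler_wsqrtr.
have sq0 : 0 < Num.sqrt c * Num.sqrt (1 - x ^+ 2).
  by rewrite mulr_gt0// sqrtr_gt0.
rewrite -!mulrA -invfM mulrA [leRHS]mulrA mulrA; apply: ler_pM.
- by rewrite mulr_ge0// ?(ltW tau_gt0)// scale_ge0.
- by rewrite invr_ge0 sqrtr_ge0.
- rewrite -mulrA mulrA; apply: ler_pM; rewrite ?(ltW tau_gt0) ?scale_ge0 ?(ltW t2)//.
  by apply: scale_le; rewrite !ger0_norm; lra.
- by rewrite lef_pV2// ?posrE// (lt_le_trans sq0).
Unshelve. all: by end_near. Qed.

Lemma denom_gt0 (tau x : R) : 0 < tau -> -1 < x < 1 -> 0 < denom tau (tau * x).
Proof.
move=> tau0 /andP[x1 x2]; rewrite sqrtr_gt0 subr_gt0.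
rewrite ltr_pXn2r ?nnegrE ?scale_ge0//; apply: scale_lt.
by rewrite normrM gtr_pMr ?ltr_norml ?x1// normr_gt0 gt_eqF.
Qed.

Lemma measurable_scale : measurable_fun setT a.
Proof. by apply: continuous_measurable_fun; exact: scale_continuous. Qed.

Lemma measurable_denomV tau : measurable_fun setT (fun t => (denom tau t)^-1).
Proof.
apply: measurable_fun_inv_ge0; last by move=> x; exact: sqrtr_ge0.
apply: measurable_fun_sqrt; apply: measurable_funB => //.
by apply: measurable_funX; exact: measurable_scale.
Qed.

(** * Joint continuity of the integrals *)

Definition rho_kernel (p : R * R) (x : R) : R :=
  if p.2 < p.1 * x then p.1 * (a (p.1 * x) / denom p.1 (p.1 * x)) else 0.

(** The factor [a p.2] is placed under the integral so that it can be weighed pointwise against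
    [1 / a]. *)
Definition theta_kernel (p : R * R) (x : R) : R :=
  if `|p.2| < p.1 * x then
    p.1 * (a p.2 * (1 / a (p.1 * x) * (a p.1 / denom p.1 (p.1 * x)))) else 0.

Definition rho_fun (p : R * R) : R :=
  \int[lebesgue_measure]_(x in `]-1, 1[) rho_kernel p x.

Definition theta_fun (p : R * R) : R :=
  \int[lebesgue_measure]_(x in `]-1, 1[) theta_kernel p x.

(** * Measurability, sign and domination of the kernels *)

Lemma measurable_rho_integrand tau :
  measurable_fun setT (fun t => a t / Num.sqrt (a tau ^+ 2 - a t ^+ 2)).
Proof.
by apply: measurable_funM; [exact: measurable_scale|exact: measurable_denomV].
Qed.

Lemma measurable_chi_integrand tau :
  measurable_fun setT
    (fun t => 1 / a t * (a tau / Num.sqrt (a tau ^+ 2 - a t ^+ 2))).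
Proof.
apply: measurable_funM; last first.
  by apply: measurable_funM => //; exact: measurable_denomV.
apply: measurable_funM => //; apply: measurable_fun_inv_ge0; last exact: scale_ge0.
exact: measurable_scale.
Qed.

Lemma rho_integrand_ge0 tau t : 0 <= a t / Num.sqrt (a tau ^+ 2 - a t ^+ 2).
Proof. by rewrite divr_ge0 ?scale_ge0 ?sqrtr_ge0. Qed.

Lemma chi_integrand_ge0 tau t :
  0 <= 1 / a t * (a tau / Num.sqrt (a tau ^+ 2 - a t ^+ 2)).
Proof.
by rewrite mulr_ge0// divr_ge0 ?scale_ge0 ?sqrtr_ge0.
Qed.

Let measurable_dilate (tau : R) (g : R -> R) :
  measurable_fun setT g -> measurable_fun setT (fun x : R => g (tau * x)).
Proof. by move=> mg; apply: (measurableT_comp mg); exact: measurable_funM. Qed.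

Lemma measurable_rho_kernel p : measurable_fun setT (rho_kernel p).
Proof.
apply: measurable_fun_ifT => //.
  by apply: measurable_fun_ltr => //; exact: measurable_funM.
apply: measurable_funM => //.
exact: (measurable_dilate p.1 (measurable_rho_integrand p.1)).
Qed.

Lemma measurable_theta_kernel p : measurable_fun setT (theta_kernel p).
Proof.
apply: measurable_fun_ifT => //.
  by apply: measurable_fun_ltr => //; exact: measurable_funM.
apply: measurable_funM => //; apply: measurable_funM => //.
exact: (measurable_dilate p.1 (measurable_chi_integrand p.1)).
Qed.

Lemma rho_kernel_ge0 p x : 0 < p.1 -> 0 <= rho_kernel p x.
Proof.
move=> p0; rewrite /rho_kernel; case: ifP => // _.
by rewrite mulr_ge0// ?(ltW p0)//; exact: rho_integrand_ge0.
Qed.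

Lemma rho_kernel_bound p x : 0 < p.1 -> -1 < x < 1 ->
  `|rho_kernel p x| <= p.1 * (a p.1 / denom p.1 (p.1 * x)).
Proof.
move=> p0 xI; have d0 := denom_gt0 p0 xI.
rewrite ger0_norm ?rho_kernel_ge0// /rho_kernel; case: ifP => _; last first.
  by rewrite mulr_ge0 ?(ltW p0)// divr_ge0 ?scale_ge0 ?ltW.
apply: ler_wpM2l; first exact: ltW.
apply: ler_wpM2r; first by rewrite invr_ge0 ltW.
apply: scale_le; rewrite normrM ger_pMr ?normr_gt0 ?gt_eqF//.
by rewrite ler_norml; move: xI => /andP[? ?]; apply/andP; split; lra.
Qed.

(* This is where [a s / a t <= 1] for [|s| < t] absorbs the singularity of [1 / a] at [0]. *)
Lemma theta_kernel_bound p x : 0 < p.1 -> -1 < x < 1 ->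
  `|theta_kernel p x| <= p.1 * (a p.1 / denom p.1 (p.1 * x)).
Proof.
move=> p0 xI; have d0 := denom_gt0 p0 xI.
have q0 : 0 <= a p.1 / denom p.1 (p.1 * x) by rewrite divr_ge0 ?scale_ge0 ?ltW.
rewrite /theta_kernel; case: ifPn => [px|_]; last first.
  by rewrite normr0 mulr_ge0 ?(ltW p0).
have ax0 : 0 < a (p.1 * x) by apply: scale_gt0; rewrite gt_eqF// (le_lt_trans _ px).
rewrite ger0_norm; last first.
  rewrite mulr_ge0 ?(ltW p0)// mulr_ge0 ?scale_ge0//.
  exact: chi_integrand_ge0.
apply: ler_wpM2l; first exact: ltW.
rewrite mulrA -[leRHS]mul1r; apply: ler_wpM2r => //.
rewrite mulrA mulr1 ler_pdivrMr// mul1r; apply: scale_le.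
by rewrite (le_trans (ltW px))// ler_norm.
Qed.

(** * Pointwise limits of the kernels, and continuity of their integrals *)

Let cvg_scale (V : topologicalType) (f : V -> R) (p : V) :
  f q @[q --> p] --> f p -> a (f q) @[q --> p] --> a (f p).
Proof. by move=> cf; apply: cvg_comp cf _; exact: scale_continuous. Qed.

Let cvg_dilate (p : R * R) (x : R) : q.1 * x @[q --> p] --> p.1 * x.
Proof. by apply: cvgM; [exact: cvg_proj1|exact: cvg_cst]. Qed.

Lemma cvg_denomV (p : R * R) (x : R) : 0 < p.1 -> -1 < x < 1 ->
  (denom q.1 (q.1 * x))^-1 @[q --> p] --> (denom p.1 (p.1 * x))^-1.
Proof.
move=> p0 xI; apply: cvgV; first by rewrite gt_eqF// denom_gt0.
apply: (@cvg_sqrt _ _ _ _ (fun q => a q.1 ^+ 2 - a (q.1 * x) ^+ 2)).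
apply: cvgB; apply: cvg_sqr; apply: cvg_scale; first exact: cvg_proj1.
exact: cvg_dilate.
Qed.

Lemma cvg_rho_kernel (p : R * R) (x : R) : 0 < p.1 -> -1 < x < 1 ->
  p.2 != p.1 * x -> rho_kernel q x @[q --> p] --> rho_kernel p x.
Proof.
move=> p0 xI px; apply: (@cvg_if_lt _ _ (fun q : R * R => q.2) (fun q => q.1 * x)
  (fun q => q.1 * (a (q.1 * x) / denom q.1 (q.1 * x)))) => //.
  exact: cvg_proj2.
move=> _; apply: cvgM; first exact: cvg_proj1.
by apply: cvgM; [apply: cvg_scale; exact: cvg_dilate|exact: cvg_denomV].
Qed.

Lemma cvg_theta_kernel (p : R * R) (x : R) : 0 < p.1 -> -1 < x < 1 ->
  `|p.2| != p.1 * x -> theta_kernel q x @[q --> p] --> theta_kernel p x.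
Proof.
move=> p0 xI px; apply: (@cvg_if_lt _ _ (fun q : R * R => `|q.2|) (fun q => q.1 * x)
  (fun q => q.1 * (a q.2 * (1 / a (q.1 * x) *
    (a q.1 / denom q.1 (q.1 * x)))))) => //.
  by apply: cvg_norm; exact: cvg_proj2.
move=> plt; apply: cvgM; first exact: cvg_proj1.
apply: cvgM; first by apply: cvg_scale; exact: cvg_proj2.
apply: cvgM.
  apply: cvgM; first exact: cvg_cst.
  apply: cvgV; first by rewrite gt_eqF// scale_gt0// gt_eqF// (le_lt_trans _ plt).
  by apply: cvg_scale; exact: cvg_dilate.
by apply: cvgM; [apply: cvg_scale; exact: cvg_proj1|exact: cvg_denomV].
Qed.

(** The argument shared by both kernels: [s] is the threshold of the cut-off, and the majorant comes
    from [denom_bound]. *)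
Lemma kernel_integral_continuous (k : R * R -> R -> R) (s : R * R -> R) (p : R * R) :
  (forall q, measurable_fun setT (k q)) ->
  (forall q x, 0 < q.1 -> -1 < x < 1 ->
    `|k q x| <= q.1 * (a q.1 / denom q.1 (q.1 * x))) ->
  (forall x, -1 < x < 1 -> s p != p.1 * x -> k q x @[q --> p] --> k p x) ->
  0 < p.1 ->
  \int[lebesgue_measure]_(x in `]-1, 1[) k q x @[q --> p] -->
  \int[lebesgue_measure]_(x in `]-1, 1[) k p x.
Proof.
move=> mk bk ck p0; have [C CP] := denom_bound p0.
apply: (@cvg_Rintegral_dominated _ _ _ _ (fun x => C * (Num.sqrt (1 - x ^+ 2))^-1)) => //.
- by move=> q; exact: measurable_funTS (mk q).
- exact: integrableZl (@integrable_arcsine R).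
- have H : \forall q \near p, 0 < q.1 /\ forall x, -1 < x < 1 ->
      q.1 * (a q.1 / denom q.1 (q.1 * x)) <= C * (Num.sqrt (1 - x ^+ 2))^-1.
    exact: (cvg_proj1 CP).
  apply: filterS H => q [q0 qC] x; rewrite /= in_itv/= => xI.
  exact: le_trans (bk _ _ q0 xI) (qC _ xI).
(* The cut-off ties at this single point, a null set. *)
- exists [set s p / p.1]; split; [exact: measurable_set1|exact: lebesgue_measure_set1|].
  move=> x /= nx; apply: contrapT => xs; apply: nx; rewrite in_itv/= => xI.
  apply: ck => //; apply: contra_notN xs => /eqP ->.
  by rewrite mulrAC divff ?mul1r// gt_eqF.
Qed.

Lemma rho_fun_continuous p : 0 < p.1 -> {for p, continuous rho_fun}.
Proof.
move=> p0; apply: (kernel_integral_continuous (s := snd)) => //.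
- exact: measurable_rho_kernel.
- exact: rho_kernel_bound.
- by move=> x; exact: cvg_rho_kernel.
Qed.

Lemma theta_fun_continuous p : 0 < p.1 -> {for p, continuous theta_fun}.
Proof.
move=> p0; apply: (kernel_integral_continuous (s := fun q => `|q.2|)) => //.
- exact: measurable_theta_kernel.
- exact: theta_kernel_bound.
- by move=> x; exact: cvg_theta_kernel.
Qed.

Lemma integrable_rho_kernel p : 0 < p.1 ->
  lebesgue_measure.-integrable `]-1, 1[ (EFin \o rho_kernel p).
Proof.
move=> p0; have [C /nbhs_singleton[_ CP]] := denom_bound p0.
have ig : lebesgue_measure.-integrable `]-1, 1[
    (fun x : R => (C%:E * (EFin \o (fun x : R => (Num.sqrt (1 - x ^+ 2))^-1)%R) x)%E).
  exact: integrableZl (@integrable_arcsine R).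
have mk : measurable_fun setT (EFin \o rho_kernel p).
  by apply/measurable_EFinP; exact: measurable_rho_kernel.
apply: le_integrable ig => //; first exact: (measurable_funTS mk).
move=> x /=; rewrite in_itv/= => xI; rewrite lee_fin.
exact: le_trans (rho_kernel_bound p0 xI) (le_trans (CP _ xI) (ler_norm _)).
Qed.

(** * Identification with the original integrals, endpoint values and monotonicity *)

Lemma integ_rho_fun (tau s : R) : 0 < tau -> - tau <= s ->
  integ s tau (fun t => a t / Num.sqrt (a tau ^+ 2 - a t ^+ 2)) = rho_fun (tau, s).
Proof.
move=> tau0 ts; rewrite integ_scale//.
  exact: measurable_rho_integrand.
exact: rho_integrand_ge0.
Qed.

(** Includes [s = 0], whatever value [chi] takes there: both sides vanish because [a 0 = 0]. *)
Lemma gth_t0_theta_fun (tau s : R) : 0 < tau -> `|s| <= tau ->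
  gth_t0 a tau s = theta_fun (tau, s) ^+ 2.
Proof.
move=> tau0 st; rewrite /gth_t0 /chi -exprMn; congr (_ ^+ 2).
rewrite integ_scale//; first last.
- exact: chi_integrand_ge0.
- exact: measurable_chi_integrand.
- by rewrite (@le_trans _ _ 0)// oppr_le0 ltW.
pose k (x : R) := if `|s| < tau * x then
  tau * (1 / a (tau * x) * (a tau / denom tau (tau * x))) else 0.
have k0 x : 0 <= k x.
  rewrite /k; case: ifP => // _.
  by rewrite mulr_ge0 ?(ltW tau0)//; exact: chi_integrand_ge0.
have mk : measurable_fun setT (EFin \o k).
  apply/measurable_EFinP; apply: measurable_fun_ifT => //.
    by apply: measurable_fun_ltr => //; exact: measurable_funM.
  apply: measurable_funM => //.
  exact: (measurable_dilate tau (measurable_chi_integrand tau)).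
rewrite /theta_fun /Rintegral -ge0_fineM ?scale_ge0//; last first.
  by apply: integral_ge0 => x _; rewrite lee_fin; exact: k0.
rewrite -ge0_integralZl//; last 3 first.
- exact: (measurable_funTS mk).
- by move=> x _; rewrite lee_fin; exact: k0.
- by rewrite lee_fin scale_ge0.
congr fine; apply: eq_integral => x _; rewrite -EFinM /theta_kernel /=.
by case: ifP => _; rewrite ?mulr0// mulrCA.
Qed.

Lemma rho_fun_diag (tau : R) : 0 < tau -> rho_fun (tau, tau) = 0.
Proof.
move=> tau0; rewrite -integ_rho_fun//; last by rewrite ge0_cp ?ltW.
by rewrite /integ set_itvoo0 integral_set0.
Qed.

(** Since [a] is even, the integral over [(-tau, tau)] is twice the one over [(0, tau)]. *)
Lemma rho_fun_antidiag (tau : R) : 0 < tau -> rho_fun (tau, - tau) = 2 * rhoM a tau.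
Proof.
move=> tau0; rewrite /rhoM integ_rho_fun ?oppr_le0 ?(ltW tau0)//.
(* Exactly one of the two summands is active for [x != 0]; at [x = 0] neither is, and the left side
   vanishes because [a 0 = 0]. *)
have split_kernel x : -1 < x < 1 -> rho_kernel (tau, - tau) x =
    rho_kernel (tau, 0) x + rho_kernel (tau, 0) (- x).
  move=> /andP[x1 x2]; rewrite /rho_kernel /= ifT; last by nra.
  rewrite mulrN /denom even_a oppr_gt0; case: (ltgtP (tau * x) 0) => tx.
  - by rewrite add0r.
  - by rewrite addr0.
  - by rewrite tx scale0 mul0r mulr0 addr0.
have mk : measurable_fun setT (EFin \o rho_kernel (tau, 0)).
  by apply/measurable_EFinP; exact: measurable_rho_kernel.
have mkN : measurable_fun setT (EFin \o (fun x => rho_kernel (tau, 0) (- x))).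
  apply/measurable_EFinP.
  apply: (measurableT_comp (measurable_rho_kernel (tau, 0))).
  exact: measurable_funN.
have k0 x : 0 <= rho_kernel (tau, 0) x by exact: rho_kernel_ge0.
rewrite /rho_fun /Rintegral.
pose I : set R := `]-1, 1[%classic.
have -> : (\int[lebesgue_measure]_(x in I) (rho_kernel (tau, - tau)%R x)%:E =
    \int[lebesgue_measure]_(x in I)
      ((rho_kernel (tau, 0%R) x)%:E + (rho_kernel (tau, 0%R) (- x)%R)%:E))%E.
  apply: eq_integral => x; rewrite inE /I /= in_itv/= => xI.
  by rewrite split_kernel// EFinD.
rewrite ge0_integralD//=; last 5 first.
- exact: measurable_itv.
- by move=> x _; rewrite lee_fin.
- exact: (measurable_funTS mk).
- by move=> x _; rewrite lee_fin.
- exact: (measurable_funTS mkN).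
have E : (\int[lebesgue_measure]_(x in I) (rho_kernel (tau, 0%R) (- x)%R)%:E =
    \int[lebesgue_measure]_(x in I) (rho_kernel (tau, 0%R) x)%:E)%E.
  rewrite [RHS](ge0_integral_opp (measurable_itv _) mk); last first.
    by move=> x; rewrite lee_fin.
  congr (integral _ _ _); apply/seteqP; split=> x; rewrite /I /= !in_itv/= => /andP[? ?];
  by apply/andP; split; lra.
have fI : (\int[lebesgue_measure]_(x in I) (rho_kernel (tau, 0%R) x)%:E)%E \is a fin_num.
  exact: (integrable_fin_num _ (@integrable_rho_kernel (tau, 0) tau0)).
by rewrite E fineD// mulr_natl mulr2n.
Qed.

(** The difference [h] of the kernels is nonnegative. Equal integrals would force [h = 0] almost
    everywhere, yet [h] is positive on an interval of length [(s' - s) / tau] except possibly at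
    0. *)
Lemma rho_fun_lt (tau s s' : R) : 0 < tau -> - tau <= s -> s < s' -> s' <= tau ->
  rho_fun (tau, s') < rho_fun (tau, s).
Proof.
move=> tau0 ts ss' s't.
have ik q : lebesgue_measure.-integrable `]-1, 1[ (EFin \o rho_kernel (tau, q)).
  exact: integrable_rho_kernel.
pose h x := rho_kernel (tau, s) x - rho_kernel (tau, s') x.
have h0 x : 0 <= h x.
  rewrite /h /rho_kernel /=; have [s'x|_] := ltP s' (tau * x).
    by rewrite (lt_trans ss' s'x) subrr.
  by rewrite subr0; exact: (@rho_kernel_ge0 (tau, s)).
pose I : set R := `]-1, 1[%classic.
have mI : measurable I by exact: measurable_itv.
have hB : \int[lebesgue_measure]_(x in I) h x = rho_fun (tau, s) - rho_fun (tau, s').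
  exact: RintegralB.
have mh : measurable_fun setT (EFin \o h).
  by apply/measurable_EFinP; apply: measurable_funB; exact: measurable_rho_kernel.
have ih : lebesgue_measure.-integrable I (EFin \o h).
  exact: (integrableB _ (ik s) (ik s')).
rewrite lt_neqAle -subr_ge0 -hB; apply/andP; split; last first.
  by apply: Rintegral_ge0 => x _; exact: h0.
apply/negP => /eqP rE.
have int0 : (\int[lebesgue_measure]_(x in I) `|(EFin \o h) x| = 0)%E.
  under eq_integral do rewrite /= ger0_norm//.
  move: hB; rewrite rE subrr /Rintegral => fin0.
  rewrite -[LHS]fineK; first by rewrite fin0.
  exact: (integrable_fin_num _ ih).
have [+ _] := ae_eq_integral_abs lebesgue_measure mI (measurable_funTS mh).
move=> /(_ int0) [N [mN N0 subN]].
pose J : set R := `]s / tau, s' / tau[%classic.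
(* The origin is set aside because the integrand vanishes there with [a]. *)
have JN : J `<=` N `|` [set 0].
  move=> x; rewrite /J /= in_itv/= ltr_pdivrMr// ltr_pdivlMr// => /andP[sx xs'].
  have [->|x0] := eqVneq x 0; [by right|left].
  apply: subN => /= H.
  have xI : -1 < x < 1 by apply/andP; split; nra.
  have : (EFin \o h) x = 0%E by apply: H; rewrite /I /= in_itv.
  rewrite /= => -[]; rewrite /h /rho_kernel /= [tau * x]mulrC sx ltNge (ltW xs') /= subr0.
  move/eqP; rewrite gt_eqF// mulr_gt0// divr_gt0//; last by rewrite mulrC denom_gt0.
  by apply: scale_gt0; rewrite mulf_neq0// gt_eqF.
have mN0 : measurable (N `|` [set 0 : R]) by exact: measurableU.
have J0 : (lebesgue_measure J <= 0)%E.
  have m1 : measurable [set 0 : R] by exact: measurable_set1.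
  have NU : (lebesgue_measure (N `|` [set 0%R]) = 0)%E.
    by apply: null_set_setU => //; exact: lebesgue_measure_set1.
  by rewrite -NU; apply: le_measure; rewrite ?inE//; exact: measurable_itv.
move: J0; rewrite /J lebesgue_measure_itv/= lte_fin ltr_pM2r ?invr_gt0// ss'.
by rewrite -EFinB lee_fin -mulrBl leNgt divr_gt0// subr_gt0.
Qed.

Let cvg_pairR (T : Type) (F : set_system T) (FF : Filter F) (f g : T -> R) (x y : R) :
  f t @[t --> F] --> x -> g t @[t --> F] --> y -> (f t, g t) @[t --> F] --> (x, y).
Proof. exact: (@cvg_pair _ _ _ F (nbhs x) (nbhs y)). Qed.

Let cvg_slice (tau s : R) : (tau, r) @[r --> s] --> (tau, s).
Proof. by apply: cvg_pairR; [exact: (@cvg_cst _ tau)|exact: cvg_id]. Qed.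

Let cvg_slice2 (p : R * R) (s : R) : (q.1, s) @[q --> p] --> (p.1, s).
Proof. by apply: cvg_pairR; [exact: cvg_proj1|exact: (@cvg_cst _ s)]. Qed.

(** * The parameter t0 and the metric coefficients *)

(** The intermediate value theorem gives a solution, so [xget] does not return its default 0; strict
    monotonicity then confines the chosen solution. It serves both for existence, on the full
    interval, and for continuity, on small ones. *)
Lemma t0_between (tau rho s1 s2 : R) : 0 < tau ->
  - tau <= s1 -> s1 <= s2 -> s2 <= tau ->
  rho_fun (tau, s2) < rho < rho_fun (tau, s1) ->
  s1 < t0 a tau rho < s2 /\ rho_fun (tau, t0 a tau rho) = rho.
Proof.
move=> tau0 ts1 s12 s2t /andP[rho2 rho1].
have [c] : exists2 c, c \in `[s1, s2]%R & rho_fun (tau, c) = rho.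
  apply: (@IVT _ (fun s => rho_fun (tau, s))) => //.
    apply: continuous_subspaceT => s.
    exact: (cvg_comp _ _ (@cvg_slice tau s) (@rho_fun_continuous (tau, s) tau0)).
  by rewrite ge_min le_max (ltW rho1) (ltW rho2) orbT.
rewrite in_itv/= => /andP[s1c cs2] rhoE.
have c1 : s1 < c.
  by rewrite lt_neqAle s1c andbT; apply: contraTneq rho1 => ->; rewrite rhoE ltxx.
have c2 : c < s2.
  by rewrite lt_neqAle cs2 andbT; apply: contraTneq rho2 => <-; rewrite rhoE ltxx.
have := @xgetPex _ 0 [set s | - tau < s < tau /\
     rho = integ s tau (fun t => a t / Num.sqrt (a tau ^+ 2 - a t ^+ 2))].
rewrite -[xget _ _]/(t0 a tau rho) => -[].
  exists c; split; first by apply/andP; split; lra.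
  by rewrite integ_rho_fun//; lra.
move=> /andP[t1 t2]; rewrite integ_rho_fun ?(ltW t1)// => tE.
split=> //; apply/andP; split; rewrite ltNge; apply/negP => h.
  move: rho1; rewrite tE ltNge => /negP; apply.
  move: h; rewrite le_eqVlt => /predU1P[->//|h]; apply/ltW/rho_fun_lt => //; lra.
move: rho2; rewrite tE ltNge => /negP; apply.
move: h; rewrite le_eqVlt => /predU1P[<-//|h]; apply/ltW/rho_fun_lt => //; lra.
Qed.

Lemma t0P (tau rho : R) : 0 < tau -> 0 < rho < 2 * rhoM a tau ->
  - tau < t0 a tau rho < tau /\ rho_fun (tau, t0 a tau rho) = rho.
Proof.
move=> tau0 /andP[rho0 rho2]; apply: t0_between; rewrite ?lexx//; first lra.
by rewrite rho_fun_diag// rho_fun_antidiag// rho0.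
Qed.

(** An inverse function argument with a parameter: [rho_fun] at [t - d] and [t + d] strictly
    brackets [p.2], and joint continuity preserves the bracket for [q] near [p]. *)
Lemma t0_continuous (p : R * R) : 0 < p.1 -> 0 < p.2 < 2 * rhoM a p.1 ->
  t0 a q.1 q.2 @[q --> p] --> t0 a p.1 p.2.
Proof.
move=> p0 pI; have [/andP[t1 t2] rE] := t0P p0 pI.
set t := t0 a p.1 p.2 in t1 t2 rE *.
apply/cvgrPdist_lt => e e0.
(* The halves keep [t - d] and [t + d] strictly inside [(- p.1, p.1)] and strictly within [e] of
   [t]. *)
pose d := Num.min (e / 2) (Num.min ((t + p.1) / 2) ((p.1 - t) / 2)).
have d0 : 0 < d.
  by rewrite !lt_min; apply/and3P; split; lra.
have [de [dl dr]] : d <= e / 2 /\ d <= (t + p.1) / 2 /\ d <= (p.1 - t) / 2.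
  by rewrite /d !ge_min !lexx /= !orbT.
have lo : rho_fun (p.1, t + d) < p.2 by rewrite -[ltRHS]rE; apply: rho_fun_lt => //; lra.
have hi : p.2 < rho_fun (p.1, t - d) by rewrite -[ltLHS]rE; apply: rho_fun_lt => //; lra.
have cr s : rho_fun (q.1, s) - q.2 @[q --> p] --> rho_fun (p.1, s) - p.2.
  apply: cvgB; last exact: cvg_proj2.
  exact: (cvg_comp _ _ (@cvg_slice2 p s) (@rho_fun_continuous (p.1, s) p0)).
have lt2 : t + d < p.1 by lra.
have lt1 : d - t < p.1 by lra.
have N1 : \forall q \near p, rho_fun (q.1, t + d) - q.2 < 0.
  by apply: (@cvgr_lt _ _ (nbhs p) _ (fun q => rho_fun (q.1, t + d) - q.2) _ (cr _));
    rewrite subr_lt0.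
have N2 : \forall q \near p, 0 < rho_fun (q.1, t - d) - q.2.
  by apply: (@cvgr_gt _ _ (nbhs p) _ (fun q => rho_fun (q.1, t - d) - q.2) _ (cr _));
    rewrite subr_gt0.
have N3 : \forall q \near p, t + d < q.1 by exact: (cvgr_gt _ (@cvg_proj1 _ _ p) _ lt2).
have N4 : \forall q \near p, d - t < q.1 by exact: (cvgr_gt _ (@cvg_proj1 _ _ p) _ lt1).
have N5 : \forall q \near p, 0 < q.1 by exact: (cvgr_gt _ (@cvg_proj1 _ _ p) _ p0).
near=> q.
have [/andP[h1 h2] _] : t - d < t0 a q.1 q.2 < t + d /\ rho_fun (q.1, t0 a q.1 q.2) = q.2.
  have n3 : t + d < q.1 by near: q.
  have n4 : d - t < q.1 by near: q.
  apply: t0_between; [by near: q|lra|lra|lra|].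
  rewrite -subr_lt0 -[X in _ && X]subr_gt0; apply/andP; split; near: q.
    exact: N1.
  exact: N2.
by rewrite ltr_norml; apply/andP; split; lra.
Unshelve. all: by end_near. Qed.

(** The identity with the square of [theta_fun] holds for [|s| <= tau], which the strict inequality
    at [p] guarantees nearby. The case [p.2 = 0] is included. *)
Lemma cvg_gth_t0 (p : R * R) : 0 < p.1 -> `|p.2| < p.1 ->
  gth_t0 a q.1 q.2 @[q --> p] --> gth_t0 a p.1 p.2.
Proof.
move=> p0 pI.
have ct : theta_fun q ^+ 2 @[q --> p] --> theta_fun p ^+ 2.
  by apply: cvg_sqr; exact: theta_fun_continuous.
rewrite gth_t0_theta_fun ?(ltW pI)// -surjective_pairing.
apply: cvg_trans ct; apply: near_eq_cvg.
have N5 : \forall q \near p, 0 < q.1 by exact: (cvgr_gt _ (@cvg_proj1 _ _ p) _ p0).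
have cn : q.1 - `|q.2| @[q --> p] --> p.1 - `|p.2|.
  by apply: cvgB; [exact: cvg_proj1|apply: cvg_norm; exact: cvg_proj2].
have N : \forall q \near p, 0 < q.1 - `|q.2|.
  by apply: (@cvgr_gt _ _ (nbhs p) _ (fun q => q.1 - `|q.2|) _ cn); rewrite subr_gt0.
apply: filterS2 N5 N => q q0 qI.
by rewrite gth_t0_theta_fun -?surjective_pairing// -subr_ge0 ltW.
Qed.

Lemma cvg_g_thth (p : R * R) : 0 < p.1 -> 0 < p.2 < 2 * rhoM a p.1 ->
  g_thth a q.1 q.2 @[q --> p] --> g_thth a p.1 p.2.
Proof.
move=> p0 pI; have [tI _] := t0P p0 pI; rewrite -ltr_norml in tI.
apply: (cvg_comp (fun q : R * R => (q.1, t0 a q.1 q.2)) (fun q => gth_t0 a q.1 q.2)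
  _ (@cvg_gth_t0 (p.1, t0 a p.1 p.2) p0 tI)).
by apply: cvg_pairR; [exact: cvg_proj1|exact: t0_continuous].
Qed.

(** Joint continuity at [(tau, 0)], restricted to the punctured neighbourhood. *)
Lemma cvg_gth_t0_0 (tau : R) : 0 < tau -> gth_t0 a tau s @[s --> 0^'] --> (0 : R).
Proof.
move=> tau0; have g0 : gth_t0 a tau 0 = 0 by rewrite /gth_t0 scale0 expr0n mul0r.
rewrite -[X in _ --> X]g0; apply: cvg_within_filter.
have n0 : `|0 : R| < tau by rewrite normr0.
exact: (cvg_comp _ _ (@cvg_slice tau 0) (@cvg_gth_t0 (tau, 0) tau0 n0)).
Qed.

(** When zeros of [g_tautau] exist, their infimum lies below any one of them, hence below
    [2 * rhoM a tau]. *)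
Lemma rho_max_le (tau rho : R) : 0 < rho < rho_max a tau -> 0 < rho < 2 * rhoM a tau.
Proof.
move=> /andP[-> /=] /lt_le_trans; apply; rewrite /rho_max; case: pselect => // -[r Sr].
have [/andP[_ /ltW r2] _] := Sr.
apply: le_trans r2; apply: ge_inf => //; exists 0 => x /= [/andP[/ltW]].
by [].
Qed.

End ScaleFactor.

Theorem theorem7p3 (R : realType) (a : R -> R) (th0 ph0 : R) :
  regular_scale_factor a ->
  (forall t, a (- t) = a t) ->
  (exists G : R -> R -> R,
     [/\ (forall tau rho th ph, Dpolar a th0 ph0 (tau, rho, th, ph) ->
            t0 a tau rho != 0 -> G tau rho = g_thth a tau rho),
         (forall tau rho th ph, Dpolar a th0 ph0 (tau, rho, th, ph) ->
            t0 a tau rho = 0 ->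
            gth_t0 a tau s @[s --> 0^'] --> G tau rho) &
         {within Dpolar a th0 ph0, continuous (fun p => G p.1.1.1 p.1.1.2)}]) /\
  (exists H : R -> R -> R -> R,
     [/\ (forall tau rho th ph, Dpolar a th0 ph0 (tau, rho, th, ph) ->
            t0 a tau rho != 0 -> H tau rho th = g_phph a tau rho th),
         (forall tau rho th ph, Dpolar a th0 ph0 (tau, rho, th, ph) ->
            t0 a tau rho = 0 ->
            gph_t0 a tau s th @[s --> 0^'] --> H tau rho th) &
         {within Dpolar a th0 ph0, continuous (fun p => H p.1.1.1 p.1.1.2 p.1.2)}]).
Proof.
move=> ra ea.
have cont p : Dpolar a th0 ph0 p ->
    g_thth a q.1.1.1 q.1.1.2 @[q --> p] --> g_thth a p.1.1.1 p.1.1.2.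
  move=> [tau0 [/rho_max_le rhoI _]].
  apply: (cvg_comp (fun q : R * R * R * R => q.1.1)
    (fun q : R * R => g_thth a q.1 q.2) _ (cvg_g_thth ra ea tau0 rhoI)).
  exact: (cvg_comp _ _ (@cvg_proj1 _ _ p) (@cvg_proj1 _ _ p.1)).
have lim0 tau rho th ph : Dpolar a th0 ph0 (tau, rho, th, ph) ->
    t0 a tau rho = 0 -> gth_t0 a tau s @[s --> 0^'] --> g_thth a tau rho.
  move=> [tau0 _] t00; rewrite /g_thth t00 /gth_t0 (scale0 ra) expr0n mul0r.
  exact: cvg_gth_t0_0.
split.
  (* No redefinition at [t0 = 0] is required: the formula already takes the limit value 0 there. *)
  exists (g_thth a); split=> //.
  by apply/subspace_continuousP => p /cont; exact: cvg_within_filter.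
exists (g_phph a); split=> //.
  move=> tau rho th ph D t00; rewrite /g_phph /gph_t0.
  by apply: cvgM; [exact: lim0 D t00|exact: cvg_cst].
apply/subspace_continuousP => p /cont cp; apply: cvg_within_filter.
rewrite /g_phph /gph_t0; apply: cvgM; first exact: cp.
apply: cvg_sqr; apply: (cvg_comp (fun q : R * R * R * R => q.1.2) (@sin R) (G := nbhs p.1.2)).
  exact: (cvg_comp _ _ (@cvg_proj1 _ _ p) (@cvg_proj2 _ _ p.1)).
exact: continuous_sin.
Qed.
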